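(* Let $N\ge 7$ be an integer. The number of spanning trees of $C_N^3$ is given by \[ \tau(C_N^3)=N\left|\frac{(1-\rho_+^N)^2}{\rho_+^{N-1}(1-\rho_+)^2}\right|^2. \]
   Context: $C_N^3$ is the graph with vertex set $\mathbb{Z}_N=\{0,1,\dots,N-1\}$ (integers modulo $N$) and edges $\{i,j\}$ with $i-j\equiv\pm r\pmod N$ for some $r\in\{1,2,3\}$. $\tau(G)$ denotes the number of spanning trees of $G$. Put $\gamma_+=\frac{-3+i\sqrt7}{2}$ (a root of $x^2+3x+4$), and let $\rho_+$ satisfy $\rho_++\rho_+^{-1}=\gamma_+$ and $|\rho_+|<1$. *)

(* Defs.v *)
From mathcomp Require Import all_boot all_order all_algebra.
From mathcomp Require Import complex.
From mathcomp Require Import boolp reals.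

Set Implicit Arguments.
Unset Strict Implicit.
Unset Printing Implicit Defensive.

Import Order.TTheory GRing.Theory Num.Theory.
Local Open Scope ring_scope.

(* A simple graph on T is a symmetric irreflexive relation e : rel T; its edges
   are the unordered pairs [set x; y], so a spanning subgraph is a set F of
   such pairs. *)

Definition edge_set (T : finType) (e : rel T) : {set {set T}} :=
  [set [set p.1; p.2] | p : T * T & e p.1 p.2].

Definition adj (T : finType) (F : {set {set T}}) : rel T :=
  [rel x y | (x != y) && ([set x; y] \in F)].

Definition connected_graph (T : finType) (F : {set {set T}}) : bool :=
  [forall x : T, forall y : T, connect (adj F) x y].

(* A single edge traversed back and forth is a ucycle of size 2; the cycles of
   a simple graph are the ucycles of size at least 3. *)
Definition acyclic_graph (T : finType) (F : {set {set T}}) : bool :=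
  `[< forall c : seq T, ucycle (adj F) c -> (size c < 3)%N >].

Definition spanning_tree (T : finType) (e : rel T) (F : {set {set T}}) : bool :=
  [&& F \subset edge_set e, connected_graph F & acyclic_graph F].

Definition num_spanning_trees (T : finType) (e : rel T) : nat :=
  #|[set F : {set {set T}} | spanning_tree e F]|.

(* The graph C_N^k: i and j are adjacent when i - j = r or i - j = - r modulo N
   for some r in {1, ..., k}. It is irreflexive only when k < N. *)
Definition cycle_power (k N : nat) : rel 'I_N :=
  [rel i j : 'I_N | has (fun r : nat =>
     (i%:Z - j%:Z == r%:Z %[mod N%:Z])%Z
     || (i%:Z - j%:Z == - r%:Z %[mod N%:Z])%Z) (iota 1 k)].

Definition gamma_plus (R : realType) : R[i] :=
  (- 3 + 'i%C * (Num.sqrt (7 : R))%:C%C) / 2.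

(* Main.v *)
Require Import Defs.
From mathcomp Require Import all_boot all_order all_algebra.
From mathcomp Require Import all_fingroup all_solvable all_field.
From mathcomp Require Import complex ring zify.
From mathcomp Require Import boolp reals.

Import Order.TTheory GRing.Theory Num.Theory.
Local Open Scope ring_scope.

Set Implicit Arguments.
Unset Strict Implicit.
Unset Printing Implicit Defensive.

(* By the matrix-tree theorem the number of spanning trees is the determinant
   of the Laplacian whose row at the root r is replaced by the unit vector.
   Expanding its rows over the choices of a neighbour f(i) for each i <> r gives
   matrices I - A_f, of determinant 1 if every vertex reaches r under f, and 0
   otherwise (the indicator vector of the vertices not reaching r is in the
   kernel). The maps f of the first kind are the parent maps of the spanning
   trees.
   For a circulant graph the Fourier matrix diagonalizes the Laplacian, which
   gives tau = (1/N) * (product of the nonzero eigenvalues). For C_N^3, with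
   w a primitive N-th root of unity and x = w^j + w^-j, the eigenvalues are
     (2 - x)(x^2 + 3x + 4)
       = (1 - w^j)(1 - w^-j)(gamma_+ - x)(gamma_- - x),
   where gamma_- is the conjugate of gamma_+, and
   gamma_+ - x = (rho - w^j)(rho - w^-j) / rho. The product over j of each
   linear factor is a geometric sum. *)

(** * Spanning trees as parent maps towards a root *)

Section Arborescence.
Variables (T : finType) (r : T) (e : rel T).

(** Fixing the value at [r] makes the parent map of a tree unique, so that maps and trees can be
    counted against each other. *)
Definition arborescence (f : {ffun T -> T}) : bool :=
  [&& [forall x, (x != r) ==> e x (f x)], f r == r & [forall x, fconnect f x r]].

Definition parent_edges (f : {ffun T -> T}) : {set {set T}} :=
  [set [set x; f x] | x in [set~ r]].

(** The depth is the least number of steps of [f] from [x] to [r]. It is the induction measure for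
    everything about parent maps. *)
Lemma fconnect_root_depth (f : T -> T) :
  (forall x, fconnect f x r) ->
  exists d : T -> nat, forall x, x != r -> (d (f x) < d x)%N.
Proof.
move=> fr.
have ex x : exists k, iter k f x == r.
  by have /iter_findex <- := fr x; exists (findex f x r).
exists (fun x => ex_minn (ex x)) => x xr.
case: (ex_minnP (ex x)) => [[|k]] /= kx _; first by rewrite kx in xr.
by case: ex_minnP => m _ /(_ k); apply; rewrite -iterSr.
Qed.

Lemma depth_fconnect_root (f : T -> T) (d : T -> nat) :
  (forall x, x != r -> (d (f x) < d x)%N) -> forall x, fconnect f x r.
Proof.
move=> df x; have [m] := ubnP (d x); elim: m x => // m IH x.
have [->|xr] := eqVneq x r; first by rewrite connect0.
rewrite ltnS => dx; apply: connect_trans (fconnect1 _ _) _.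
by apply: IH; apply: leq_trans dx; apply: df.
Qed.

Lemma set2_eq_cases (x y a b : T) : [set x; y] = [set a; b] ->
  (x = a /\ y = b) \/ (x = b /\ y = a).
Proof.
move=> E.
have: [&& x \in [set a; b], y \in [set a; b], a \in [set x; y] & b \in [set x; y]].
  by rewrite -{1 2}E {3 4}E !set21 !set22.
rewrite !inE => /and4P [].
by do 4!(case/orP => /eqP ?); subst; auto.
Qed.

Lemma parent_edgesP (f : {ffun T -> T}) (x y : T) :
  reflect ((x != r /\ y = f x) \/ (y != r /\ x = f y))
    ([set x; y] \in parent_edges f).
Proof.
apply: (iffP imsetP) => [[z]|[[xr ->]|[yr ->]]].
- by rewrite !inE => zr /set2_eq_cases [[-> ->]|[-> ->]]; [left|right].
- by exists x; rewrite ?inE.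
- by exists y; rewrite ?inE // setUC.
Qed.

Lemma adj_sym (F : {set {set T}}) : symmetric (adj F).
Proof. by move=> x y; rewrite /adj /= eq_sym setUC. Qed.

Lemma arborescence_depth (f : {ffun T -> T}) : arborescence f ->
  exists d : T -> nat, forall x, x != r -> (d (f x) < d x)%N.
Proof. by case/and3P=> _ _ /forallP; apply: fconnect_root_depth. Qed.

Lemma adj_parent (f : {ffun T -> T}) (x : T) :
  arborescence f -> x != r -> adj (parent_edges f) x (f x).
Proof.
move=> /arborescence_depth [d df] xr /=; apply/andP; split; last first.
  by apply/parent_edgesP; left.
by apply/eqP => E; have := df x xr; rewrite -E ltnn.
Qed.

Lemma connected_parent_edges (f : {ffun T -> T}) :
  arborescence f -> connected_graph (parent_edges f).
Proof.
move=> af; have [d df] := arborescence_depth af.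
have toroot x : connect (adj (parent_edges f)) x r.
  have [m] := ubnP (d x); elim: m x => // m IH x.
  have [->|xr] := eqVneq x r; first by rewrite connect0.
  rewrite ltnS => dx; apply: connect_trans (connect1 (adj_parent _ _)) _ => //.
  by apply: IH; apply: leq_trans dx; apply: df.
apply/forallP => x; apply/forallP => y.
by apply: connect_trans (toroot x) _; rewrite (sym_connect_sym (@adj_sym _)).
Qed.

(* At a vertex of maximal depth on a cycle both neighbours would have to be
   its parent. *)
Lemma acyclic_parent_edges (f : {ffun T -> T}) :
  arborescence f -> acyclic_graph (parent_edges f).
Proof.
move=> /arborescence_depth [d df]; apply/asboolP => c /andP [cyc un].
case: c cyc un => // x0 c' ; set c := x0 :: c' => cyc un.
case: (@arg_maxnP _ x0 (mem c) d (mem_head _ _)) => x xc dmax.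
rewrite ltnNge; apply/negP => c3.
have up y : y \in c -> adj (parent_edges f) x y -> y = f x.
  move=> yc /andP [_ /parent_edgesP [[_ //]|[yr xy]]].
  by have := leq_trans (df _ yr) (dmax _ yc); rewrite -xy ltnn.
have [i s Ec] := rot_to xc.
have sc z : z \in x :: s -> z \in c by rewrite -Ec mem_rot.
move: c3; rewrite -(size_rot i) Ec.
move: cyc un; rewrite -(rot_cycle i) -(rot_uniq i) Ec.
case: s sc {Ec} => [|y s] //; case: (lastP s) => {}s // z sc.
rewrite /path.cycle rcons_path last_cons last_rcons.
case/andP=> /andP [xy _] zx.
rewrite (up y) ?sc ?inE ?eqxx ?orbT //.
have -> : z = f x.
  by apply: up; rewrite 1?adj_sym // sc // !(inE, mem_rcons) eqxx !orbT.
by rewrite /= mem_rcons inE eqxx /= andbF.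
Qed.

(** Induction on the depth in [f]. If the edge from [x] to [f x] is not the parent edge of [x] under
    [g], then [g (f x) = x]; by induction [f (f x) = x], although the depth has dropped twice. *)
Lemma parent_edges_inj : {in arborescence &, injective parent_edges}.
Proof.
move=> f g af ag E; have [d df] := arborescence_depth af.
have [_ /eqP fr _] := and3P af; have [_ /eqP gr _] := and3P ag.
apply/ffunP => x; have [m] := ubnP (d x); elim: m x => // m IH x.
rewrite ltnS => dx; have [->|xr] := eqVneq x r; first by rewrite fr gr.
have /parent_edgesP [[_ //]|[fxr gfx]] : [set x; f x] \in parent_edges g.
  by rewrite -E; apply/parent_edgesP; left.
have Ef : f (f x) = g (f x) by apply: IH; apply: leq_trans dx; apply: df.
have := ltn_trans (df _ fxr) (df _ xr).
by rewrite Ef -gfx ltnn.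
Qed.

(* If every edge of a connected spanning subgraph lies in the tree F, so does F
   itself: an extra edge of F would close a cycle. *)
Lemma connected_subtree (E F : {set {set T}}) :
  E \subset F -> connected_graph E -> acyclic_graph F ->
  forall x y, adj F x y -> [set x; y] \in E.
Proof.
move=> EF /forallP cE /asboolP aF x y xy.
have /forallP /(_ y) /connectP [p0 p0E yp0] := cE x.
case/shortenP: p0E yp0 => p pE up _ yp.
have pF : path (adj F) x p.
  apply: sub_path pE => a b /andP [ab abE].
  by rewrite /adj /= ab (subsetP EF).
have := aF (x :: p); rewrite /ucycle /path.cycle rcons_path pF -yp adj_sym xy.
rewrite up => /(_ isT).
case: p pE yp {up pF} => [_ /= yx|z [|//] /=].
  by move: xy; rewrite yx /adj /= eqxx.
by move=> + -> _; rewrite andbT => /andP [].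
Qed.

(** The parent of [x] is a neighbour in [F] at smaller distance from the root; one exists because a
    shortest walk to the root can drop its first vertex. *)
Lemma spanning_tree_parent (F : {set {set T}}) : symmetric e -> irreflexive e ->
  spanning_tree e F -> exists2 f, arborescence f & F = parent_edges f.
Proof.
move=> esym eirr /and3P [Fe cF aF].
have adjE x y : adj F x y -> e x y.
  case/andP=> _ /(subsetP Fe) /imsetP [[a b]]; rewrite inE /= => ab.
  by case/set2_eq_cases => [[-> ->]|[-> ->]] //; rewrite esym.
have ex x : exists n,
    [exists p : n.-tuple T, path (adj F) x p && (last x p == r)].
  have /forallP /(_ x) /forallP /(_ r) /connectP [p pF pr] := cF.
  exists (size p); apply/existsP; exists (in_tuple p).
  by rewrite /= pF -pr eqxx.
pose d x := ex_minn (ex x).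
have step x : x != r -> exists y, adj F x y && (d y < d x)%N.
  move=> xr; rewrite {2}/d; case: (ex_minnP (ex x)) => n + _.
  move=> /existsP [[p /= /eqP pn] /andP [pF pr]].
  case: p pn pF pr => [_ _ /= pr|y p /= pn pF pr]; first by rewrite pr in xr.
  have /andP [xy {}pF] := pF; exists y; rewrite xy -pn ltnS.
  rewrite /d; case: ex_minnP => m _; apply; apply/existsP; exists (in_tuple p).
  by rewrite /= pF.
(* The default [r] of [odflt] is never taken, by [step]. *)
pose f := [ffun x => if x == r then r else
  odflt r [pick y | adj F x y && (d y < d x)%N]].
have fP x : x != r -> adj F x (f x) && (d (f x) < d x)%N.
  move=> xr; rewrite ffunE (negPf xr); case: pickP => //= nop.
  by have [y] := step _ xr; rewrite nop.
have af : arborescence f.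
  apply/and3P; split; last 1 first.
  - apply/forallP; apply: (@depth_fconnect_root _ d) => x /fP /andP [] //.
  - by apply/forallP => x; apply/implyP => /fP /andP [/adjE].
  - by rewrite ffunE eqxx.
have subF : parent_edges f \subset F.
  apply/subsetP => _ /imsetP [x + ->].
  by rewrite !inE => /fP /andP [/andP [_ xF] _].
(* The parent edges form a connected spanning subgraph of the tree [F], hence exhaust it. *)
exists f => //; apply/eqP; rewrite eqEsubset subF andbT; apply/subsetP => a aF'.
have /imsetP [[x y]] := subsetP Fe _ aF'; rewrite inE /= => exy axy.
rewrite axy in aF' *.
apply: (connected_subtree subF) => //; first exact: connected_parent_edges.
rewrite /adj /= aF' andbT; apply/eqP => xy.
by rewrite xy eirr in exy.
Qed.

Lemma num_spanning_trees_arborescence : symmetric e -> irreflexive e ->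
  num_spanning_trees e = #|[set f | arborescence f]|.
Proof.
move=> esym eirr.
rewrite -(card_in_imset (f := parent_edges)); last first.
  by move=> f g; rewrite !inE; apply: parent_edges_inj.
congr #|pred_of_set _|; apply/setP => F; rewrite inE; apply/idP/imsetP.
  by move=> /(spanning_tree_parent esym eirr) [f af ->]; exists f; rewrite ?inE.
case=> f; rewrite inE => af ->; apply/and3P; split.
- apply/subsetP => _ /imsetP [x + ->]; rewrite !inE => xr.
  have /and3P [/forallP /(_ x) /implyP /(_ xr) xfx _ _] := af.
  by apply/imsetP; exists (x, f x); rewrite ?inE.
- exact: connected_parent_edges.
- exact: acyclic_parent_edges.
Qed.
End Arborescence.

(** * The matrix-tree theorem by multilinear expansion of rows *)

Lemma det_sum_rows (R : comNzRingType) (n : nat) (K : finType)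
    (B : 'I_n -> K -> 'I_n -> R) :
  \det (\matrix_(i, j) \sum_k B i k j) =
  \sum_(f : {ffun 'I_n -> K}) \det (\matrix_(i, j) B i (f i) j).
Proof.
rewrite /determinant exchange_big /=; apply: eq_bigr => s _.
rewrite -big_distrr /=; congr (_ * _).
under eq_bigr do rewrite mxE.
rewrite bigA_distr_bigA; apply: eq_bigr => f _.
by apply: eq_bigr => i _; rewrite mxE.
Qed.

Definition parent_mx (R : nzRingType) (n : nat) (r : 'I_n) (f : 'I_n -> 'I_n) :
    'M[R]_n :=
  \matrix_(i, j) ((i == j)%:R - ((i != r) && (f i == j))%:R).

(* Only the identity contributes to the Leibniz expansion: a contributing
   permutation never increases the depth, and preserves its sum. *)
Lemma det_parent_mx1 (R : comNzRingType) (n : nat) (r : 'I_n) (f : 'I_n -> 'I_n)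
    (d : 'I_n -> nat) :
  (forall x, x != r -> (d (f x) < d x)%N) -> \det (parent_mx R r f) = 1.
Proof.
move=> df; rewrite /determinant (bigD1 1%g) //= odd_perm1 expr0 mul1r.
rewrite [X in X + _]big1 ?[X in _ + X]big1 ?addr0 // => [s s1|i _]; last first.
  rewrite mxE perm1 eqxx; case: (eqVneq i r) => [|ir]; rewrite ?subr0 //=.
  by case: eqP => [E|]; rewrite ?subr0 //; have := df _ ir; rewrite E ltnn.
have [i /andP [si di]] : exists i, (s i != i) && (d i <= d (s i))%N.
  apply/existsP; apply: contraR s1 => /existsPn nos.
  have ds i : (d (s i) <= d i ?= iff (s i == i))%N.
    have [->|si] := eqVneq (s i) i; first by split; rewrite ?leqnn ?eqxx.
    by have := nos i; rewrite si -ltnNge => lt; split; rewrite ?ltn_eqF // ltnW.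
  have [_] := leqif_sum (fun i (_ : true) => ds i).
  rewrite [X in _ == X](reindex_inj (@perm_inj _ s)) eqxx => /esym /forallP s_id.
  by apply/eqP/permP => i; rewrite perm1; apply/eqP/s_id.
rewrite (bigD1 i) //= mxE eq_sym (negPf si) sub0r.
case: (boolP (_ && _)) => [/andP [ir /eqP E]|_]; last first.
  by rewrite oppr0 !(mul0r, mulr0).
by have := df _ ir; rewrite E ltnNge di.
Qed.

Lemma det_parent_mx (R : idomainType) (n : nat) (r : 'I_n) (f : 'I_n -> 'I_n) :
  f r = r -> \det (parent_mx R r f) = [forall x, fconnect f x r]%:R.
Proof.
move=> fr; case: (boolP [forall x, _]) => [/forallP /fconnect_root_depth [d df]|].
  exact: det_parent_mx1 df.
rewrite negb_forall => /existsP [x xr]; apply/eqP; rewrite -det_tr; apply/det0P.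
(* This vector vanishes at [r] and takes equal values at [i] and [f i] for every other [i], so every
   row of [parent_mx] kills it. *)
exists (\row_i (~~ fconnect f i r)%:R).
  by apply/eqP => /rowP /(_ x); rewrite !mxE xr; apply/eqP; rewrite oner_eq0.
apply/rowP => i; rewrite !mxE.
under eq_bigr do rewrite !mxE mulrBr -!natrM !mulnb.
rewrite sumrB (bigD1 i) //= eqxx andbT big1 ?addr0; last first.
  by move=> j ji; rewrite eq_sym (negPf ji) andbF.
have [->|ir] := eqVneq i r.
  by rewrite connect0 big1 ?subr0 // => j _; rewrite andbF.
rewrite (bigD1 (f i)) //= eqxx andbT big1 ?addr0; last first.
  by move=> j ji; rewrite eq_sym (negPf ji) andbF.
suff -> : fconnect f i r = fconnect f (f i) r by rewrite subrr.
apply/idP/idP => [/iter_findex|fir]; last first.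
  exact: connect_trans (fconnect1 _ _) fir.
case: (findex _ _ _) => [/= E|k /= E]; first by rewrite E eqxx in ir.
by rewrite -E -iterS iterSr fconnect_iter.
Qed.

(** Each Laplacian row is kept as a sum with one term per neighbour, the form that [det_sum_rows]
    expands. *)
Definition laplacian_rooted (R : nzRingType) (n : nat) (r : 'I_n) (e : rel 'I_n) :
    'M[R]_n :=
  \matrix_(i, j) if i == r then (i == j)%:R
                 else \sum_k (e i k)%:R * ((i == j)%:R - (k == j)%:R).

Theorem matrix_tree (R : idomainType) (n : nat) (r : 'I_n) (e : rel 'I_n) :
  symmetric e -> irreflexive e ->
  (num_spanning_trees e)%:R = \det (laplacian_rooted R r e).
Proof.
move=> esym eirr; rewrite (num_spanning_trees_arborescence r esym eirr).
(* The root gets itself as its only admissible choice, so that its unit row is also a sum over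
   [k]. *)
pose c i k := if i == r then k == r else e i k.
pose B i k j : R := (c i k)%:R * ((i == j)%:R - ((i != r) && (k == j))%:R).
have -> : laplacian_rooted R r e = \matrix_(i, j) \sum_k B i k j.
  apply/matrixP => i j; rewrite !mxE /B /c; have [->|ir] //= := eqVneq i r.
  rewrite (bigD1 r) //= eqxx mul1r subr0 big1 ?addr0 // => k kr.
  by rewrite (negPf kr) mul0r.
rewrite det_sum_rows -sum1_card natr_sum big_mkcond /=; apply: eq_bigr => f _.
rewrite inE; have [/forallP cf|] := boolP [forall i, c i (f i)].
  have fr : f r = r by apply/eqP; have := cf r; rewrite /c eqxx.
  have -> : (\matrix_(i, j) B i (f i) j) = parent_mx R r f.
    by apply/matrixP => i j; rewrite !mxE /B cf mul1r.
  rewrite det_parent_mx // /arborescence fr eqxx /=.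
  have -> : [forall x, (x != r) ==> e x (f x)].
    apply/forallP => x; apply/implyP => xr.
    by have := cf x; rewrite /c (negPf xr).
  by case: [forall x, _].
(* An inadmissible choice at [i] makes row [i] zero. *)
rewrite negb_forall => /existsP [i ci].
have -> : arborescence r e f = false.
  apply/negbTE; apply: contra ci => /and3P [/forallP /(_ i) /implyP ei fr _].
  by rewrite /c; case: eqVneq => [->|/ei].
rewrite (expand_det_row _ i) big1 // => j _.
by rewrite mxE /B (negPf ci) !mul0r.
Qed.

(** * Roots of unity and Laplacians of circulant graphs *)

Lemma prim_root_exists (F : closedFieldType) (n : nat) :
  n%:R != 0 :> F -> exists z : F, n.-primitive_root z.
Proof.
move=> nF; have n0 : (0 < n)%N by rewrite lt0n; apply: contraNneq nF => ->.
have [s Es] := closed_field_poly_normal ('X^n - 1 : {poly F}).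
rewrite (monicP _) ?monicXnsubC // scale1r in Es.
suff /hasP [z _ zn] : has n.-primitive_root s by exists z.
(* Since [n] is nonzero in [F], the polynomial X^n - 1 is separable, and [s] lists [n] distinct
   roots. *)
apply: has_prim_root => //.
- by apply/allP => z; rewrite -root_prod_XsubC -Es.
- by rewrite -separable_prod_XsubC -Es separable_Xn_sub_1.
- by rewrite -ltnS -(size_prod_XsubC s id) -Es size_XnsubC.
Qed.

Section Circulant.
Variables (F : fieldType) (n : nat) (w : F).
Hypothesis wn : n.+1.-primitive_root w.

Definition dft_mx : 'M[F]_n.+1 := \matrix_(i, j) w ^+ (i * j).

(** Orthogonality of characters: off the diagonal, the entry is a full geometric sum of a root of
    unity other than 1. *)
Lemma dft_mx_inv : dft_mx *m (\matrix_(i, j) (w ^+ (i * j))^-1) = (n.+1%:R)%:M.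
Proof.
have w0 : w != 0 by rewrite (prim_root_eq0 wn).
apply/matrixP => i k; rewrite !mxE.
pose z := w ^+ i / w ^+ k.
have -> : \sum_l dft_mx i l * (\matrix_(i, j) (w ^+ (i * j))^-1) l k =
          \sum_(l < n.+1) z ^+ l.
  by apply: eq_bigr => l _; rewrite !mxE [(l * k)%N]mulnC !exprM expr_div_n.
have [ik|ik] := eqVneq i k.
  have -> : z = 1 by rewrite /z ik divff ?expf_neq0.
  by under eq_bigr do rewrite expr1n; rewrite sumr_const card_ord mulr1n.
have z1 : z - 1 != 0.
  rewrite subr_eq0; apply: contra ik => /eqP zE.
  have : w ^+ i == w ^+ k.
    by rewrite -[w ^+ i](divfK (expf_neq0 k w0)) -/z zE mul1r.
  by rewrite (eq_prim_root_expr wn) !modn_small.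
apply: (mulfI z1); rewrite -subrX1 mulr0 /z expr_div_n -!exprM.
rewrite mulnC [(k * _)%N]mulnC !exprM (prim_expr_order wn) !expr1n.
by rewrite divr1 subrr.
Qed.

Lemma dft_mx_neq0 : \det dft_mx != 0.
Proof.
have nF := prim_root_natf_neq0 wn.
have := congr1 determinant dft_mx_inv; rewrite det_mulmx det_scalar => E.
by apply: contraTneq (expf_neq0 n.+1 nF) => d0; rewrite -E d0 mul0r eqxx.
Qed.

(** Evaluates the minor of the Fourier matrix left over when row and column 0 are deleted in
    [det_laplacian_circulant]. *)
Lemma adj_dft_mx : n.+1%:R * (\adj dft_mx) 0 0 = \det dft_mx.
Proof.
have := congr1 (mulmx (\adj dft_mx)) dft_mx_inv.
rewrite mulmxA mul_adj_mx mul_scalar_mx mul_mx_scalar => /matrixP /(_ 0 0).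
by rewrite !mxE muln0 expr0 invr1 mulr1 => ->.
Qed.

Variables (s : seq 'I_n.+1) (e : rel 'I_n.+1).
Hypothesis s_uniq : uniq s.
Hypothesis eE : forall i d : 'I_n.+1, e i (i + d) = (d \in s).

(** In the product with the Fourier matrix, row 0 is all ones and, in the other rows, column [j] is
    scaled by the eigenvalue [lam j]. As [lam 0 = 0], column 0 is a unit vector; expanding along it
    leaves a Fourier minor times the other eigenvalues. *)
Lemma det_laplacian_circulant :
  n.+1%:R * \det (laplacian_rooted F 0 e) =
  \prod_(j < n) \sum_(d <- s) (1 - w ^+ (d * j.+1)).
Proof.
pose lam (j : 'I_n.+1) := \sum_(d <- s) (1 - w ^+ (d * j)).
set L := laplacian_rooted F 0 e.
have LV i j : i != 0 -> (L *m dft_mx) i j = dft_mx i j * lam j.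
  move=> i0; rewrite !mxE.
  under eq_bigr => l _ do rewrite !mxE (negPf i0) big_distrl /=.
  rewrite exchange_big /= (reindex_inj (addrI i)) /=.
  rewrite /lam big_distrr /= [RHS]big_uniq //.
  rewrite [RHS]big_mkcond /=; apply: eq_bigr => d _.
  under eq_bigr => l _ do rewrite -mulrA.
  rewrite -big_distrr /= eE; case: (d \in s); last by rewrite mul0r.
  rewrite mul1r; under eq_bigr => l _ do rewrite mulrBl.
  rewrite sumrB (bigD1 i) //= eqxx mul1r big1 ?addr0; last first.
    by move=> l li; rewrite eq_sym (negPf li) mul0r.
  rewrite (bigD1 (i + d)) //= eqxx mul1r big1 ?addr0; last first.
    by move=> l li; rewrite eq_sym (negPf li) mul0r.
  by rewrite mulrBr mulr1 -exprD -mulnDl /= !exprM (prim_expr_mod wn).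
have LV0 j : (L *m dft_mx) 0 j = 1.
  rewrite !mxE (bigD1 0) //= !mxE eqxx mul0n mul1r big1 ?addr0 // => l l0.
  by rewrite !mxE eqxx eq_sym (negPf l0) mul0r.
have : \det (L *m dft_mx) = (\adj dft_mx) 0 0 * \prod_(j < n) lam (lift 0 j).
  rewrite (expand_det_col _ 0) (bigD1 0) //= LV0 mul1r big1 ?addr0; last first.
    move=> i i0; rewrite LV // /lam big1 ?mulr0 ?mul0r // => d _.
    by rewrite muln0 expr0 subrr.
  rewrite !mxE /cofactor -mulrA; congr (_ * _).
  pose D := diag_mx (\row_j lam (lift 0 j)).
  have -> : row' 0 (col' 0 (L *m dft_mx)) = row' 0 (col' 0 dft_mx) *m D.
    apply/matrixP => i j; rewrite mul_mx_diag [LHS]mxE [LHS]mxE LV ?neq_lift //.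
    by rewrite !mxE.
  rewrite det_mulmx det_diag; congr (_ * _).
  by apply: eq_bigr => j _; rewrite mxE.
rewrite det_mulmx => E.
apply: (mulIf dft_mx_neq0); rewrite -mulrA E mulrA adj_dft_mx mulrC.
by congr (_ * _); apply: eq_bigr => j _; rewrite /lam lift0.
Qed.

(** Cancel X - 1 from the factorization of X^(n+1) - 1, then evaluate at [y]. *)
Lemma prod_sub_prim_root (y : F) :
  \prod_(j < n) (y - w ^+ j.+1) = \sum_(k < n.+1) y ^+ k.
Proof.
pose p : {poly F} := \prod_(j < n) ('X - (w ^+ j.+1)%:P).
suff -> : \prod_(j < n) (y - w ^+ j.+1) = p.[y].
  have -> : p = \sum_(k < n.+1) 'X^k.
    have X1 : 'X - 1 != 0 :> {poly F} by rewrite -polyC1 polyXsubC_eq0.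
    apply: (mulfI X1); rewrite -subrX1 -(factor_Xn_sub_1 wn) big_mkord.
    by rewrite big_ord_recl expr0 polyC1.
  by rewrite horner_sum; apply: eq_bigr => k _; rewrite hornerXn.
by rewrite horner_prod; apply: eq_bigr => k _; rewrite hornerXsubC.
Qed.
End Circulant.

Lemma prim_rootV (F : fieldType) (n : nat) (w : F) :
  n.+1.-primitive_root w -> n.+1.-primitive_root w^-1.
Proof.
move=> wn; have w0 : w != 0 by rewrite (prim_root_eq0 wn).
have -> : w^-1 = w ^+ n.
  by apply: (mulfI w0); rewrite divff // -exprS (prim_expr_order wn).
by rewrite prim_root_exp_coprime // coprimenS.
Qed.

(** * The graph C_N^3 as a circulant graph, with N = n + 1 *)

Lemma cycle_power_sym (k N : nat) : symmetric (@cycle_power k N).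
Proof.
have opp (a b : int) : b = - a -> (N%:Z %| a)%Z = (N%:Z %| b)%Z.
  by move=> ->; rewrite rpredN.
move=> i j; apply: eq_has => r; rewrite !eqz_mod_dvd orbC.
by congr (_ || _); apply: opp; lia.
Qed.

Section CyclePower3.
Variable n : nat.
Hypothesis n6 : (6 <= n)%N.

(** The residues of 1, 2, 3, -1, -2, -3 modulo n + 1; they are distinct because n + 1 is at least
    7. *)
Definition shifts3 : seq 'I_n.+1 :=
  [seq inord k | k <- [:: 1; 2; 3; n; n.-1; n.-2]%N].

Lemma val_shifts3 : map val shifts3 = [:: 1; 2; 3; n; n.-1; n.-2]%N.
Proof. by rewrite /shifts3 /= !inordK //; lia. Qed.

Lemma mem_shifts3 (d : 'I_n.+1) :
  (d \in shifts3) = ((d : nat) \in [:: 1; 2; 3; n; n.-1; n.-2]%N).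
Proof. by rewrite -val_shifts3 (mem_map val_inj _ d). Qed.

Lemma uniq_shifts3 : uniq shifts3.
Proof. rewrite -(map_inj_uniq val_inj) val_shifts3 /= !inE; lia. Qed.

Lemma cycle_power3_shift (i d : 'I_n.+1) :
  cycle_power 3 i (i + d) = (d \in shifts3).
Proof.
have shift x : (i%:Z - ((i + d)%R : 'I_n.+1)%:Z == x %[mod n.+1%:Z])%Z =
               (n.+1%:Z %| d%:Z + x)%Z.
  rewrite eqz_mod_dvd.
  have -> : i%:Z - ((i + d)%R : 'I_n.+1)%:Z - x =
            ((i + d) %/ n.+1)%N%:Z * n.+1%:Z - (d%:Z + x).
    rewrite /=; have := divn_eq (i + d) n.+1; lia.
  by rewrite rpredBl ?dvdz_mull.
(* As d lies in [0, n], divisibility of d + r by n + 1 pins d down to n + 1 - r. *)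
have plus r : (0 < r < 4)%N ->
    (n.+1%:Z %| d%:Z + r%:Z)%Z = ((d : nat) == n.+1 - r)%N.
  move=> r4; have dn := ltn_ord d.
  have -> : d%:Z + r%:Z = (d%:Z - (n.+1 - r)%N%:Z) + n.+1%:Z by lia.
  by rewrite rpredDr ?dvdzz // -eqz_mod_dvd !modz_nat eqz_nat !modn_small //; lia.
have minus r : (0 < r < 4)%N -> (n.+1%:Z %| d%:Z - r%:Z)%Z = ((d : nat) == r).
  move=> r4; have dn := ltn_ord d.
  by rewrite -eqz_mod_dvd !modz_nat eqz_nat !modn_small //; lia.
rewrite mem_shifts3 /cycle_power /= !shift !plus // !minus // !inE; lia.
Qed.

Lemma cycle_power3_irr : irreflexive (@cycle_power 3 n.+1).
Proof.
move=> i; rewrite -[X in cycle_power _ _ X]addr0 cycle_power3_shift.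
by rewrite mem_shifts3 !inE /=; lia.
Qed.

Variables (F : fieldType) (w rho1 rho2 : F).
Hypothesis wn : n.+1.-primitive_root w.
Hypotheses (rho1_neq0 : rho1 != 0) (rho2_neq0 : rho2 != 0).
Hypothesis sum_rho : rho1 + rho1^-1 + (rho2 + rho2^-1) = - 3.
Hypothesis prod_rho : (rho1 + rho1^-1) * (rho2 + rho2^-1) = 4.

(** [sum_rho] and [prod_rho] are Vieta's relations for x^2 + 3x + 4, here evaluated at x = z +
    1/z. *)
Lemma eigenvalue_factor (z : F) : z != 0 ->
  6 - (z + z ^+ 2 + z ^+ 3 + z^-1 + z ^- 2 + z ^- 3) =
  (1 - z) * (1 - z^-1) * ((rho1 - z) * (rho1 - z^-1) / rho1) *
  ((rho2 - z) * (rho2 - z^-1) / rho2).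
Proof.
move=> z0; have quot (rho : F) : rho != 0 ->
    (rho - z) * (rho - z^-1) / rho = (rho + rho^-1) - (z + z^-1).
  by move=> r0; field; rewrite z0.
rewrite !quot //; set x := z + z^-1.
have -> : (1 - z) * (1 - z^-1) = 2 - x by rewrite /x; field.
rewrite -mulrA.
have -> : (rho1 + rho1^-1 - x) * (rho2 + rho2^-1 - x) =
  (rho1 + rho1^-1) * (rho2 + rho2^-1) -
  (rho1 + rho1^-1 + (rho2 + rho2^-1)) * x + x ^+ 2 by ring.
by rewrite sum_rho prod_rho /x; field.
Qed.

Lemma sum_shifts3 (j : nat) : let z := w ^+ j in
  \sum_(d <- shifts3) (1 - w ^+ (d * j)) =
  6 - (z + z ^+ 2 + z ^+ 3 + z^-1 + z ^- 2 + z ^- 3).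
Proof.
move=> z; have w0 : w != 0 by rewrite (prim_root_eq0 wn).
have z0 : z != 0 by rewrite expf_neq0.
have zn : z ^+ n.+1 = 1.
  by rewrite -exprM mulnC exprM (prim_expr_order wn) expr1n.
have zV k : (k <= n.+1)%N -> w ^+ ((n.+1 - k) * j) = z ^- k.
  move=> kn; rewrite mulnC exprM -/z; apply: (mulIf (expf_neq0 k z0)).
  by rewrite -exprD subnK // zn mulVf // expf_neq0.
have zX k : w ^+ (k * j) = z ^+ k by rewrite mulnC exprM.
rewrite -(big_map val predT (fun d => 1 - w ^+ (d * j))) val_shifts3.
rewrite !big_cons big_nil !zX.
have n1 : n = (n.+1 - 1)%N by lia.
have n2 : n.-1 = (n.+1 - 2)%N by lia.
have n3 : n.-2 = (n.+1 - 3)%N by lia.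
rewrite -!zX n3 n2 [in w ^+ (n * j)]n1 !zV ?zX; try lia.
by rewrite /= !expr1; ring.
Qed.

Theorem det_laplacian_cycle_power3 :
  \det (laplacian_rooted F 0 (@cycle_power 3 n.+1)) =
  n.+1%:R * ((\sum_(k < n.+1) rho1 ^+ k) ^+ 2 / rho1 ^+ n) *
            ((\sum_(k < n.+1) rho2 ^+ k) ^+ 2 / rho2 ^+ n).
Proof.
have nF := prim_root_natf_neq0 wn; apply: (mulfI nF).
rewrite (det_laplacian_circulant wn uniq_shifts3 cycle_power3_shift).
have w0 : w != 0 by rewrite (prim_root_eq0 wn).
under eq_bigr => j _ do
  rewrite sum_shifts3 eigenvalue_factor ?expf_neq0 // -exprVn.
rewrite !big_split /= !(prod_sub_prim_root wn).
rewrite !(prod_sub_prim_root (prim_rootV wn)).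
rewrite !prodr_const !card_ord !exprVn.
(* The factors 1 - z and 1 - 1/z each contribute n + 1; one of the two cancels against the factor
   from [det_laplacian_circulant]. *)
have -> : \sum_(k < n.+1) (1 : F) ^+ k = n.+1%:R.
  by under eq_bigr do rewrite expr1n; rewrite sumr_const card_ord.
by field; rewrite !expf_neq0.
Qed.
End CyclePower3.

(** * The complex parameters and the closed formula *)

Lemma gamma_plus_conj (R : realType) :
  (gamma_plus R)^* = (- 3 - 'i%C * (Num.sqrt (7 : R))%:C%C) / 2.
Proof.
have iC : ('i%C : R[i])^* = - 'i%C by rewrite complexiE conjCi.
have sC : ((Num.sqrt (7 : R))%:C%C)^* = (Num.sqrt (7 : R))%:C%C.
  exact: conjc_real.
by rewrite /gamma_plus fmorph_div rmorphD rmorphN rmorphM !rmorph_nat /=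
  iC sC mulNr.
Qed.

Lemma gamma_plus_add_conj (R : realType) : gamma_plus R + (gamma_plus R)^* = - 3.
Proof. by rewrite gamma_plus_conj /gamma_plus; field. Qed.

Lemma gamma_plus_mul_conj (R : realType) : gamma_plus R * (gamma_plus R)^* = 4.
Proof.
have s2 : ((Num.sqrt (7 : R))%:C)%C ^+ 2 = 7 :> R[i].
  by rewrite -rmorphXn /= sqr_sqrtr ?ler0n // rmorph_nat.
have E (i s : R[i]) :
    (- 3 + i * s) / 2 * ((- 3 - i * s) / 2) = (9 - i ^+ 2 * s ^+ 2) / 4.
  by field.
by rewrite gamma_plus_conj /gamma_plus E sqr_i s2; field.
Qed.

Theorem corollary4p9 (R : realType) (N : nat) (hN : (7 <= N)%N) (rho : R[i])
    (hrho : rho + rho^-1 = gamma_plus R) (hrho1 : `|rho| < 1) :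
  (num_spanning_trees (@cycle_power 3 N))%:R =
    N%:R * `|(1 - rho ^+ N) ^+ 2 / (rho ^+ N.-1 * (1 - rho) ^+ 2)| ^+ 2 :> R[i].
Proof.
case: N hN => // n n6.
have [w wn] : exists w : R[i], n.+1.-primitive_root w.
  by apply: prim_root_exists; rewrite pnatr_eq0.
rewrite (matrix_tree R[i] 0 (@cycle_power_sym 3 n.+1) (cycle_power3_irr n6)).
(* With the convention 0^-1 = 0, a zero [rho] would give gamma_+ = 0, against gamma_+ times its
   conjugate being 4. *)
have rho0 : rho != 0.
  apply/eqP => r0; have := gamma_plus_mul_conj R.
  rewrite -hrho r0 invr0 addr0 mul0r => /esym/eqP.
  by rewrite pnatr_eq0.
have rhoC : rho^* + (rho^*)^-1 = (gamma_plus R)^*.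
  by rewrite -hrho rmorphD /= fmorphV.
rewrite (@det_laplacian_cycle_power3 _ n6 _ w rho (rho^*) wn) ?hrho ?rhoC ?conjC_eq0
  ?gamma_plus_add_conj ?gamma_plus_mul_conj //.
(* The bound on the modulus excludes [rho = 1], so the geometric sum has its closed form. *)
have r1 : 1 - rho != 0.
  rewrite subr_eq0; apply/eqP => r1.
  by move: hrho1; rewrite -r1 normr1 ltxx.
(* The squared modulus is a number times its conjugate: these are the factors of [rho] and of its
   conjugate in the determinant. *)
rewrite normCK -mulrA; congr (_ * _).
have -> : (1 - rho ^+ n.+1) ^+ 2 / (rho ^+ n * (1 - rho) ^+ 2) =
   (\sum_(k < n.+1) rho ^+ k) ^+ 2 / rho ^+ n.
  rewrite -opprB subrX1 -(opprB rho).
  by field; rewrite expf_neq0 // -opprB oppr_eq0 r1.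
rewrite fmorph_div !rmorphXn rmorph_sum /=.
by congr (_ * (_ ^+ 2 / _)); apply: eq_bigr => k _; rewrite rmorphXn.
Qed.
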